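(* Let $L\ge1$ be an integer and $\lambda\in[0,1]$. The maximum error of the depth-$L$ D-NMDT MIP relaxation $P_{\mathrm{D\text{-}NMDT}}$ (with parameter $\lambda$) for $z=xy$ with $x,y\in[0,1]$ is $$\mathcal E^{\max}\bigl(P_{\mathrm{D\text{-}NMDT}},\operatorname{gra}_{[0,1]^2}(xy)\bigr)=\tfrac14\,(2^{-L}\cdot 2^{-L})=2^{-2L-2}.$$
   Context: McCormick envelope: for quantities $p\in[\underline p,\overline p]$, $q\in[\underline q,\overline q]$, $\mathcal M(p,q)$ denotes the set of $(p,q,r)\in[\underline p,\overline p]\times[\underline q,\overline q]\times\mathbb R$ with $\underline p q+p\underline q-\underline p\,\underline q\le r\le \overline p q+p\underline q-\overline p\,\underline q$ and $\overline p q+p\overline q-\overline p\,\overline q\le r\le \underline p q+p\overline q-\underline p\,\overline q$. For a binary variable the bounds used are $[0,1]$. Depth-$L$ D-NMDT MIP relaxation $P_{\mathrm{D\text{-}NMDT}}$ of $z=xy$ with parameter $\lambda\in[0,1]$: the set of all $(x,y,z,\Delta_x,\Delta_y,\Delta_z,u,v,\beta^x,\beta^y)$ with $z,\Delta_z\in\mathbb R$, $u,v\in\mathbb R^L$, satisfying $x=\sum_{j=1}^L2^{-j}\beta^x_j+\Delta_x$; $y=\sum_{j=1}^L2^{-j}\beta^y_j+\Delta_y$; $z=\sum_{j=1}^L2^{-j}(u_j+v_j)+\Delta_z$; $(\lambda\Delta_y+(1-\lambda)y,\beta^x_j,u_j)\in\mathcal M(\lambda\Delta_y+(1-\lambda)y,\beta^x_j)$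 and $((1-\lambda)\Delta_x+\lambda x,\beta^y_j,v_j)\in\mathcal M((1-\lambda)\Delta_x+\lambda x,\beta^y_j)$ for $j=1,\dots,L$; $(\Delta_x,\Delta_y,\Delta_z)\in\mathcal M(\Delta_x,\Delta_y)$; $\Delta_x,\Delta_y\in[0,2^{-L}]$, $x,y\in[0,1]$, $\beta^x,\beta^y\in\{0,1\}^L$. The bounds used in the McCormick envelopes are $\lambda\Delta_y+(1-\lambda)y\in[0,\lambda2^{-L}+(1-\lambda)]$, $(1-\lambda)\Delta_x+\lambda x\in[0,(1-\lambda)2^{-L}+\lambda]$ and $\Delta_x,\Delta_y\in[0,2^{-L}]$. Let $\operatorname{gra}_{[0,1]^2}(xy)=\{(x,y,z)\in[0,1]^2\times\mathbb R: z=xy\}$. The maximum error $\mathcal E^{\max}(P,\operatorname{gra}_{[0,1]^2}(xy))$ is the maximum of $|z-xy|$ over all $(x,y,z)$ in the projection of $P$ onto the $(x,y,z)$-space. *)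

(* Defs.v *)
From mathcomp Require Import all_boot all_order all_algebra.
From mathcomp Require Import mathcomp_extra boolp classical_sets reals.
Set Implicit Arguments.
Unset Strict Implicit.
Unset Printing Implicit Defensive.
Import Order.TTheory GRing.Theory Num.Theory.
Local Open Scope classical_set_scope.
Local Open Scope ring_scope.

(* The triples (p, q, r) of the McCormick envelope of r = p * q over the box
   [pl, pu] x [ql, qu]; the bounds on p and q are part of the envelope. *)
Definition mccormick (R : realType) (pl pu ql qu : R) : set (R * R * R) :=
  [set t | let: (p, q, r) := t in
    [/\ pl <= p <= pu,
        ql <= q <= qu,
        pl * q + p * ql - pl * ql <= r <= pu * q + p * ql - pu * ql &
        pu * q + p * qu - pu * qu <= r <= pl * q + p * qu - pl * qu]].

Record dnmdt_point (R : realType) (L : nat) := DnmdtPoint {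
  nm_x : R;
  nm_y : R;
  nm_z : R;
  nm_dx : R;
  nm_dy : R;
  nm_dz : R;
  nm_u : 'rV[R]_L;
  nm_v : 'rV[R]_L;
  nm_bx : 'rV[R]_L;
  nm_by : 'rV[R]_L
}.

(* Vectors are indexed from 0, so the j-th entry has weight 2 ^- j.+1. *)
Definition dnmdt (R : realType) (L : nat) (lambda : R) :
    set (dnmdt_point R L) :=
  [set w | let: DnmdtPoint x y z dx dy dz u v bx by_ := w in
    [/\ [/\ x = \sum_(j < L) 2 ^- j.+1 * bx 0 j + dx,
            y = \sum_(j < L) 2 ^- j.+1 * by_ 0 j + dy &
            z = \sum_(j < L) 2 ^- j.+1 * (u 0 j + v 0 j) + dz],
        [/\ forall j : 'I_L,
              mccormick 0 (lambda * 2 ^- L + (1 - lambda)) 0 1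
                (lambda * dy + (1 - lambda) * y, bx 0 j, u 0 j),
            forall j : 'I_L,
              mccormick 0 ((1 - lambda) * 2 ^- L + lambda) 0 1
                ((1 - lambda) * dx + lambda * x, by_ 0 j, v 0 j) &
            mccormick 0 (2 ^- L) 0 (2 ^- L) (dx, dy, dz)],
        [/\ 0 <= dx <= 2 ^- L, 0 <= dy <= 2 ^- L,
            0 <= x <= 1 & 0 <= y <= 1] &
        forall j : 'I_L,
          (bx 0 j = 0 \/ bx 0 j = 1) /\ (by_ 0 j = 0 \/ by_ 0 j = 1)]].
Arguments dnmdt [R] L lambda.

Definition proj_xyz (R : realType) (L : nat) (P : set (dnmdt_point R L)) :
    set (R * R * R) :=
  [set (nm_x w, nm_y w, nm_z w) | w in P].

(* e is the maximum (attained, not merely the supremum) of |z - f x y| over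
   the points (x, y, z) of Q, i.e. the maximum error of Q with respect to the
   graph of f. The domain of f is not an argument: for dnmdt the constraints
   already put (x, y) in [0, 1]^2. *)
Definition is_max_error (R : realType) (f : R -> R -> R)
    (Q : set (R * R * R)) (e : R) : Prop :=
  let errors := [set `|t.2 - f t.1.1 t.1.2| | t in Q] in
  errors e /\ ubound errors e.

(* Main.v *)
(* For binary q the McCormick envelope forces r = p * q, so every product
   u_j, v_j is exact. Whatever lambda is, the exact products recombine to
   z - x * y = Delta_z - Delta_x * Delta_y, and only the McCormick error of the
   continuous product on [0, 2^-L]^2 remains; it is at most a quarter of the
   area of the box, with equality at its midpoint. *)
Require Import Defs.
From mathcomp Require Import all_boot all_order all_algebra.
From mathcomp Require Import mathcomp_extra boolp classical_sets reals.
From mathcomp Require Import ring lra.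
Set Implicit Arguments.
Unset Strict Implicit.
Unset Printing Implicit Defensive.
Import Order.TTheory GRing.Theory Num.Theory.
Local Open Scope classical_set_scope.
Local Open Scope ring_scope.

Lemma mccormick_binary (R : realType) (pl pu p q r : R) :
  q = 0 \/ q = 1 -> mccormick pl pu 0 1 (p, q, r) -> r = p * q.
Proof. by move=> [] -> [_ _ /andP[? ?] /andP[? ?]]; lra. Qed.

(** A quantity below both [a] and [b] is below their geometric mean; this combines two McCormick
    planes that bound the same error. *)
Lemma le_of_mul_le_sqr (R : realDomainType) (m a b c : R) :
  0 <= c -> m <= a -> m <= b -> a * b <= c ^+ 2 -> m <= c.
Proof.
move=> c0 ma mb abc; rewrite leNgt; apply/negP => cm.
have m0 : 0 <= m by apply: le_trans (ltW cm).
have := le_trans (ler_pM m0 m0 ma mb) abc.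
by rewrite leNgt expr2 ltr_pM.
Qed.

Lemma mul_subr_le_sqr_half (R : realFieldType) (a s : R) :
  s * (a - s) <= (a / 2) ^+ 2.
Proof.
rewrite -subr_ge0.
have -> : (a / 2) ^+ 2 - s * (a - s) = (a / 2 - s) ^+ 2 by field.
exact: sqr_ge0.
Qed.

(** Each sign of the error has two bounding planes, whose gaps to [p * q] are products of distances
    to the box sides. For either sign the two gaps multiply to the product in [prod_le], which AM-GM
    bounds in each coordinate. *)
Lemma mccormick_error (R : realType) (pl pu ql qu p q r : R) :
  mccormick pl pu ql qu (p, q, r) ->
  `|r - p * q| <= (pu - pl) * (qu - ql) / 4.
Proof.
move=> [/andP[p1 p2] /andP[q1 q2] /andP[r1 r2] /andP[r3 r4]].
have c0 : 0 <= (pu - pl) * (qu - ql) / 4.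
  by rewrite divr_ge0 // mulr_ge0 // subr_ge0 (le_trans p1, le_trans q1).
have prod_le : ((p - pl) * (pu - p)) * ((q - ql) * (qu - q)) <=
    ((pu - pl) * (qu - ql) / 4) ^+ 2.
  have -> : ((pu - pl) * (qu - ql) / 4) ^+ 2 =
      ((pu - pl) / 2) ^+ 2 * ((qu - ql) / 2) ^+ 2 by field.
  apply: ler_pM; rewrite ?mulr_ge0 ?subr_ge0 //.
    by rewrite (_ : pu - p = pu - pl - (p - pl)) ?mul_subr_le_sqr_half //; ring.
  by rewrite (_ : qu - q = qu - ql - (q - ql)) ?mul_subr_le_sqr_half //; ring.
rewrite ler_norml lerNl; apply/andP; split.
(* Underestimation: the gaps of the two lower planes. *)
- apply: (@le_of_mul_le_sqr _ _ ((p - pl) * (q - ql)) ((pu - p) * (qu - q)));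
    [by [] | by lra | by lra |].
  by lra.
(* Overestimation: the gaps of the two upper planes. *)
- apply: (@le_of_mul_le_sqr _ _ ((pu - p) * (q - ql)) ((p - pl) * (qu - q)));
    [by [] | by lra | by lra |].
  by lra.
Qed.

Lemma dnmdt_error (R : realType) (L : nat) (lambda : R) (w : dnmdt_point R L) :
  dnmdt L lambda w -> nm_z w - nm_x w * nm_y w = nm_dz w - nm_dx w * nm_dy w.
Proof.
case: w => x y z dx dy dz u v bx by_ /= [[hx hy hz] [hu hv _] _ hb].
set p := lambda * dy + (1 - lambda) * y in hu.
set q := (1 - lambda) * dx + lambda * x in hv.
have -> : z = p * (x - dx) + q * (y - dy) + dz.
  have -> : x - dx = \sum_(j < L) 2 ^- j.+1 * bx 0 j by rewrite hx addrK.
  have -> : y - dy = \sum_(j < L) 2 ^- j.+1 * by_ 0 j by rewrite hy addrK.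
  rewrite hz !mulr_sumr -big_split /=; congr (_ + _); apply: eq_bigr => j _.
  rewrite (mccormick_binary (hb j).1 (hu j)) (mccormick_binary (hb j).2 (hv j)).
  by ring.
(* All terms in [lambda] cancel: [p * (x - dx) + q * (y - dy) = x * y - dx * dy]. *)
by rewrite /p /q; ring.
Qed.

(** With all bits zero, [x = dx] and [y = dy] sit at the middle of [[0, 2^-L]], where both lower
    planes of the residual envelope take the value 0, chosen for [dz]. *)
Definition dnmdt_worst_point (R : realType) (L : nat) : dnmdt_point R L :=
  let h := 2 ^- L / 2 in DnmdtPoint h h 0 h h 0 0 0 0 0.

Lemma dnmdt_worst_point_in (R : realType) (L : nat) (lambda : R) :
  0 <= lambda <= 1 -> dnmdt L lambda (dnmdt_worst_point R L).
Proof.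
move=> /andP[l0 l1]; rewrite /dnmdt_worst_point /=.
have h0 : 0 < 2 ^- L :> R by rewrite invr_gt0 exprn_gt0.
have h1 : 2 ^- L <= 1 :> R by rewrite invf_le1 ?exprn_gt0 ?exprn_ege1 ?ler1n.
move: (2 ^- L) h0 h1 => h h0 h1.
have sum0 (a : nat -> R) : \sum_(j < L) a j * (0 : 'rV[R]_L) 0 j = 0.
  by apply: big1 => j _; rewrite mxE mulr0.
split.
- split; rewrite ?(sum0 (fun j => 2 ^- j.+1)) ?add0r //.
  by rewrite big1 ?addr0 // => j _; rewrite !mxE addr0 mulr0.
(* The bounds [lambda * h + (1 - lambda)] and [(1 - lambda) * h + lambda] are convex combinations of
   [h] and 1, hence at least [h] by [h1], so they admit the value [h / 2]. *)
- by split=> [j|j|]; rewrite ?mxE; split; apply/andP; split; nra.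
- by split; apply/andP; split; lra.
- by move=> j; rewrite !mxE; split; left.
Qed.

Theorem proposition2 (R : realType) (L : nat) (lambda : R)
    (hL : (1 <= L)%N) (hlambda : 0 <= lambda <= 1) :
  is_max_error (fun x y : R => x * y) (proj_xyz (dnmdt L lambda))
    (4^-1 * (2 ^- L * 2 ^- L))
  /\ (4^-1 * (2 ^- L * 2 ^- L) : R) = 2 ^- (2 * L + 2)%N.
Proof.
split; last first.
  rewrite mul2n -addnn !exprD.
  by field; rewrite expf_neq0 ?pnatr_eq0.
split.
- exists (2 ^- L / 2, 2 ^- L / 2, 0) => /=.
    by exists (dnmdt_worst_point R L) => //; exact: dnmdt_worst_point_in.
  rewrite sub0r normrN ger0_norm; last first.
    by rewrite mulr_ge0 ?divr_ge0 ?invr_ge0 ?exprn_ge0.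
  by field; rewrite expf_neq0 ?pnatr_eq0.
(* What remains is the error of the residual envelope, over a square of side [2 ^- L]. *)
- move=> _ [_ [w hw <-] <-] /=; rewrite (dnmdt_error hw).
  case: w hw => x y z dx dy dz u v bx by_ /= [_ [_ _ /mccormick_error hd] _ _].
  by rewrite !subr0 in hd; rewrite [leRHS]mulrC.
Qed.
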